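(* Let $X$ be a Banach $\mathbb{A}$-bimodule. The following assertions hold. (a) If $T:[0,\infty)\to\mathscr{L}^{r}(X)$ is a uniformly continuous semigroup, then $T$ is differentiable and, setting $A:=T'(0)\in\mathscr{L}^{r}(X)$, one has $T'(t)=A\,T(t)$ for all $t\ge 0$ and $T(0)=\mathrm{Id}$. Moreover $T(t)=e^{tA}$ for all $t\ge 0$. (b) If $A\in\mathscr{L}^{r}(X)$, the map $T:[0,\infty)\to\mathscr{L}^{r}(X)$, $t\mapsto e^{tA}$, is a uniformly continuous semigroup and it is the unique solution of the Cauchy problem $T'(t)=A\,T(t)$ for all $t\ge0$, $T(0)=\mathrm{Id}$.
   Context: Algebra. $\mathbb{A}$ is a finite dimensional real alternative algebra with unity $1\ne 0$ (a real vector space with an $\mathbb{R}$-bilinear product, not necessarily associative or commutative, such that $\alpha(\alpha\beta)=(\alpha\alpha)\beta$ and $(\alpha\beta)\beta=\alpha(\beta\beta)$); $\mathbb{R}$ is identified with $\mathbb{R}\cdot 1\subseteq\mathbb{A}$. It is equipped with an anti-involution $\alpha\mapsto\alpha^c$: $\mathbb{R}$-linear, $(\alpha^c)^c=\alpha$, $(\alpha\beta)^c=\beta^c\alpha^c$, $r^c=r$ for $r\in\mathbb{R}$. Put $t(\alpha)=\alpha+\alpha^c$, $n(\alpha)=\alpha\alpha^c$; quadratic cone $Q_{\mathbb{A}}:=\mathbb{R}\cup\{\alpha\in\mathbb{A}: t(\alpha),n(\alpha)\in\mathbb{R},\ t(\alpha)^2-4n(\alpha)<0\}$; $\mathbb{S}_{\mathbb{A}}:=\{\mathbf{j}\in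 Q_{\mathbb{A}}:\mathbf{j}^2=-1\}$. It is assumed that $\mathbb{S}_{\mathbb{A}}\neq\emptyset$ and that $\mathbb{A}$ is endowed with a norm $|\cdot|$ (as a real vector space) with $|\alpha|=\sqrt{n(\alpha)}$ for every $\alpha\in Q_{\mathbb{A}}$. Bimodules. An $\mathbb{A}$-bimodule is an abelian group $V$ with a left scalar multiplication $\mathbb{A}\times V\to V$ and a right scalar multiplication $V\times\mathbb{A}\to V$, both additive in each argument, with $1u=u=u1$, and $r(su)=(rs)u$, $(ur)s=u(rs)$, $ru=ur$ for $r,s\in\mathbb{R}$; if $\mathbb{A}$ is associative it is also required that $\alpha(\beta u)=(\alpha\beta)u$, $(u\alpha)\beta=u(\alpha\beta)$, $\alpha(u\beta)=(\alpha u)\beta$ for all $\alpha,\beta\in\mathbb{A}$. ${}_{\mathbb{R}}V$ denotes $V$ as a real vector space. A norm on $V$ is a function $\|\cdot\|:V\to[0,\infty)$ with $\|u\|=0\iff u=0$, $\|u+v\|\le\|u\|+\|v\|$, $\|\alpha u\|\le|\alpha|\|u\|$ and $\|u\alpha\|\le|\alpha|\|u\|$ for $\alpha\in\mathbb{A}$, and $\|\alpha u\|=\|u\alpha\|=|\alpha|\|u\|$ for $\alpha\in Q_{\mathbb{A}}$. $V$ with such a norm is a normed $\mathbb{A}$-bimodule, and a Banach $\mathbb{A}$-bimodule if the norm is complete. Operators. $\mathscr{L}^{r}(X)$ is the set of additive maps $A:X\to X$ with $A(u\alpha)=A(u)\alpha$ for all $u\in X,\alpha\in\mathbb{A}$ (right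 linear) and finite operator norm $\|A\|=\sup_{u\ne0}\|Au\|/\|u\|$; it is a real normed space with this norm, and continuity and differentiability of $\mathscr{L}^r(X)$-valued maps of a real variable are meant with respect to this norm. $e^{tA}=\sum_{n\ge0}(tA)^n/n!$. Semigroups. A semigroup in $X$ is a map $T:[0,\infty)\to\mathscr{L}^{r}(X)$ with $T(t+s)=T(t)T(s)$ for all $t,s>0$ and $T(0)=\mathrm{Id}$. It is uniformly continuous if it is continuous as a map into $\mathscr{L}^{r}(X)$ with the operator norm. *)

(* Defs.v *)
From HB Require Import structures.
From mathcomp Require Import all_boot all_order all_algebra.
From mathcomp Require Import all_classical all_reals all_analysis.

Set Implicit Arguments.
Unset Strict Implicit.
Unset Printing Implicit Defensive.

Import Order.TTheory GRing.Theory Num.Theory.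
Import numFieldNormedType.Exports.
Local Open Scope classical_set_scope.
Local Open Scope ring_scope.

(* Finite dimensional real alternative algebras. [GRing.Algebra] is not usable
   here because the product need not be associative. *)
HB.mixin Record Vector_isAlternative (R : realType) A & Vector R A := {
  aone : A;
  amul : A -> A -> A;
  aone_neq0 : aone != 0;
  amul1l : left_id aone amul;
  amul1r : right_id aone amul;
  amulDl : left_distributive amul +%R;
  amulDr : right_distributive amul +%R;
  amulZl : forall (r : R) a b, amul (r *: a) b = r *: amul a b;
  amulZr : forall (r : R) a b, amul a (r *: b) = r *: amul a b;
  amul_altl : forall a b, amul a (amul a b) = amul (amul a a) b;
  amul_altr : forall a b, amul (amul a b) b = amul a (amul b b)
}.

#[short(type="altAlgType")]
HB.structure Definition AltAlgebra (R : realType) :=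
  {A of Vector R A & Vector_isAlternative R A}.

Definition areal (R : realType) (A : altAlgType R) (r : R) : A := r *: aone.

HB.mixin Record AltAlgebra_hasAntiInvolution (R : realType) A
    & AltAlgebra R A := {
  aconj : A -> A;
  aconjD : {morph aconj : a b / a + b};
  aconjZ : forall (r : R) a, aconj (r *: a) = r *: aconj a;
  aconjK : involutive aconj;
  aconjM : forall a b, aconj (amul a b) = amul (aconj b) (aconj a);
  aconj_real : forall r : R, aconj (areal _ r) = areal _ r
}.

#[short(type="starAltAlgType")]
HB.structure Definition StarAltAlgebra (R : realType) :=
  {A of AltAlgebra R A & AltAlgebra_hasAntiInvolution R A}.

Section QuadraticCone.
Variables (R : realType) (A : starAltAlgType R).
Implicit Types a : A.

Definition atrace a : A := a + aconj a.
Definition asqnorm a : A := amul a (aconj a).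

Definition quadratic_cone : set A :=
  range (areal A) `|`
  [set a | exists t n : R,
    [/\ atrace a = areal A t, asqnorm a = areal A n & t ^+ 2 - 4 * n < 0]].

Definition imaginary_units : set A :=
  [set j | quadratic_cone j /\ amul j j = - aone].

End QuadraticCone.
Arguments quadratic_cone {R} A.
Arguments imaginary_units {R} A.

(* The norm of the algebra is only a norm of real vector spaces; on the
   quadratic cone, where [asqnorm a] is real, it is the square root of it. *)
HB.mixin Record StarAltAlgebra_isConeNormed (R : realType) A
    & StarAltAlgebra R A := {
  anorm : A -> R;
  anorm0_eq0 : forall a, anorm a = 0 -> a = 0;
  anormD : forall a b, anorm (a + b) <= anorm a + anorm b;
  anormZ : forall (r : R) a, anorm (r *: a) = `|r| * anorm a;
  anorm_cone : forall (a : A) (n : R),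
    quadratic_cone A a -> asqnorm a = areal A n -> anorm a = Num.sqrt n;
  imaginary_units_neq0 : imaginary_units A !=set0
}.

#[short(type="coneAlgType")]
HB.structure Definition ConeAlgebra (R : realType) :=
  {A of StarAltAlgebra R A & StarAltAlgebra_isConeNormed R A}.

(* The underlying normed module over R is the real normed space of the
   bimodule: [lact_real] and [ract_real] identify its scaling with the actions
   of the reals on both sides, so that 1u = u = u1, r(su) = (rs)u,
   (ur)s = u(rs) and ru = ur are the module axioms. *)
HB.mixin Record NormedModule_isBimodule (R : realType) (A : coneAlgType R) X
    & NormedModule R X := {
  lact : A -> X -> X;
  ract : X -> A -> X;
  lactDl : forall a b u, lact (a + b) u = lact a u + lact b u;
  lactDr : forall a u v, lact a (u + v) = lact a u + lact a v;
  ractDl : forall u v a, ract (u + v) a = ract u a + ract v a;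
  ractDr : forall u a b, ract u (a + b) = ract u a + ract u b;
  lact_real : forall (r : R) u, lact (areal A r) u = r *: u;
  ract_real : forall (r : R) u, ract u (areal A r) = r *: u;
  bimod_assoc : associative (@amul R A) ->
    [/\ forall a b u, lact a (lact b u) = lact (amul a b) u,
        forall u a b, ract (ract u a) b = ract u (amul a b)
      & forall a u b, lact a (ract u b) = ract (lact a u) b];
  ler_norm_lact : forall a u, `|lact a u| <= anorm a * `|u|;
  ler_norm_ract : forall u a, `|ract u a| <= anorm a * `|u|;
  norm_lact_cone : forall a u,
    quadratic_cone A a -> `|lact a u| = anorm a * `|u|;
  norm_ract_cone : forall u a,
    quadratic_cone A a -> `|ract u a| = anorm a * `|u|
}.

#[short(type="normedBimodType")]
HB.structure Definition NormedBimodule (R : realType) (A : coneAlgType R) :=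
  {X of NormedModule R X & NormedModule_isBimodule R A X}.

#[short(type="banachBimodType")]
HB.structure Definition BanachBimodule (R : realType) (A : coneAlgType R) :=
  {X of NormedBimodule R A X & CompleteNormedModule R X}.

(* Homogeneity over R is not an axiom of the actions nor of right linear maps:
   it follows from additivity and boundedness. *)
Lemma additive_bounded_scale (R : realType) (V W : normedModType R)
    (f : V -> W) (M : R) :
  {morph f : u v / u + v} -> (forall u, `|f u| <= M * `|u|) ->
  forall (r : R) u, f (r *: u) = r *: f u.
Proof.
move=> fD fM r u; apply/eqP; rewrite -subr_eq0 -normr_eq0; apply/eqP.
set d := (X in `|X|).
have f0 : f 0 = 0 by apply: (addrI (f 0)); rewrite -fD !addr0.
have fN v : f (- v) = - f v.
  by apply: (addrI (f v)); rewrite -fD !subrr.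
have fMn v n : f (v *+ n) = f v *+ n.
  by elim: n => [|n IH]; rewrite ?mulr0n // !mulrS fD IH.
have fMz v (k : int) : f (k%:~R *: v) = k%:~R *: f v.
  rewrite !scaler_int; case: k => n; first exact: fMn.
  by rewrite !NegzE !mulrNz fN fMn.
pose C := M * `|u| + M * `|u|.
have Mu : 0 <= M * `|u| by apply: le_trans (fM u).
have dn n : n%:R * `|d| <= C.
  pose x : R := n%:R * r; pose th := x - (Num.floor x)%:~R.
  have xE : x = (Num.floor x)%:~R + th by rewrite /th addrC subrK.
  have th0 : 0 <= th by rewrite subr_ge0 Num.Theory.ge_floor.
  have th1 : th <= 1.
    rewrite lerBlDl ltW // (lt_le_trans (Num.Theory.lt_succ_floor x)) //.
    by rewrite intrD.
  have fth v : `|th *: v| <= `|v|.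
    by rewrite normrZ ger0_norm // ler_piMl.
  have -> : n%:R * `|d| = `|f (th *: u) - th *: f u|.
    rewrite -[n%:R in LHS]ger0_norm // -normrZ /d scalerBr scalerA.
    rewrite !scaler_nat -fMn -scaler_nat scalerA -/x xE !scalerDl fD fMz.
    by rewrite opprD addrACA subrr add0r.
  rewrite (le_trans (ler_normB _ _)) // lerD //; last first.
    by rewrite (le_trans (fth _ _)).
  case: (leP 0 M) => M0; first by rewrite (le_trans (fM _)) // ler_wpM2l.
  have u0 : `|u| = 0.
    by apply/eqP; rewrite eq_le normr_ge0 andbT -(nmulr_rge0 _ M0).
  have -> : u = 0 by apply/normr0_eq0.
  by rewrite scaler0 f0 !normr0 mulr0.
apply/eqP; rewrite eq_le normr_ge0 andbT leNgt; apply/negP => d0.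
have := dn (Num.bound (C / `|d|)); apply/negP; rewrite -ltNge -ltr_pdivrMr //.
by apply: archi_boundP; rewrite divr_ge0 // addr_ge0.
Qed.

Section RightOperators.
Variables (R : realType) (A : coneAlgType R) (X : normedBimodType A).

Definition opquot (f : X -> X) : set R :=
  [set `|f u| / `|u| | u in [set u : X | u != 0]].

Definition right_operator : set (X -> X) :=
  [set f | [/\ {morph f : u v / u + v},
               forall u (a : A), f (ract u a) = ract (f u) a
             & has_ubound (opquot f)]].

Definition right_op_pred : {pred X -> X} := mem right_operator.

Record rop := ROp { rop_fun :> X -> X; rop_funP : rop_fun \in right_op_pred }.

HB.instance Definition _ := [isSub for rop_fun].
HB.instance Definition _ := [Choice of rop by <:].

Lemma right_op_predP f : reflect (right_operator f) (f \in right_op_pred).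
Proof. by apply: (iffP idP) => [/set_mem|/mem_set]. Qed.

Lemma opquot_ubound (f : X -> X) (M : R) : f 0 = 0 ->
  ubound (opquot f) M <-> (forall u, `|f u| <= M * `|u|).
Proof.
move=> f0; split=> [fM u|fM _ [u /= u0 <-]]; last first.
  by rewrite ler_pdivrMr ?normr_gt0.
have [->|u0] := eqVneq u 0; first by rewrite f0 !normr0 mulr0.
by rewrite -ler_pdivrMr ?normr_gt0 //; apply: fM; exists u.
Qed.

Lemma right_operatorP (f : X -> X) :
  right_operator f <->
  [/\ {morph f : u v / u + v},
      forall u (a : A), f (ract u a) = ract (f u) a
    & exists M, forall u, `|f u| <= M * `|u|].
Proof.
have f0 : {morph f : u v / u + v} -> f 0 = 0.
  by move=> fD; apply: (addrI (f 0)); rewrite -fD !addr0.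
split=> -[fD fA [M fM]]; split=> //; exists M; move: fM;
  by move=> /(opquot_ubound _ (f0 fD)).
Qed.

Lemma ractZ (r : R) (u : X) (a : A) : ract (r *: u) a = r *: ract u a.
Proof.
apply: (@additive_bounded_scale R X X (fun v => ract v a) (anorm a)).
  by move=> v w; rewrite ractDl.
by move=> v; apply: ler_norm_ract.
Qed.

Lemma right_op_submod_closed : submod_closed right_op_pred.
Proof.
split=> [|r f g].
  apply/right_op_predP/right_operatorP; split=> [u v|u a|].
  - by rewrite addr0.
  - by rewrite -[0 u](scale0r u) ractZ scale0r.
  - by exists 0 => u; rewrite normr0 mul0r.
move=> /right_op_predP/right_operatorP[fD fA [M fM]].
move=> /right_op_predP/right_operatorP[gD gA [N gN]].
have fgE w : (r *: f + g) w = r *: f w + g w by [].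
apply/right_op_predP/right_operatorP; split=> [u v|u a|].
- by rewrite !fgE fD gD scalerDr addrACA.
- by rewrite !fgE ractDl ractZ fA gA.
- exists (`|r| * M + N) => u; rewrite fgE (le_trans (ler_normD _ _)) //.
  by rewrite mulrDl lerD // normrZ -mulrA ler_wpM2l.
Qed.

HB.instance Definition _ :=
  GRing.isSubmodClosed.Build R (X -> X) right_op_pred right_op_submod_closed.
HB.instance Definition _ := [SubChoice_isSubLmodule of rop by <:].

Lemma rop_comp_proof (f g : rop) : f \o g \in right_op_pred.
Proof.
have /right_op_predP/right_operatorP[fD fA [M fM]] := rop_funP f.
have /right_op_predP/right_operatorP[gD gA [N gN]] := rop_funP g.
apply/right_op_predP/right_operatorP; split=> [u v|u a|] /=.
- by rewrite gD fD.
- by rewrite gA fA.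
- exists (`|M| * N) => u; rewrite (le_trans (fM _)) //.
  rewrite (@le_trans _ _ (`|M| * `|g u|)) //.
    by rewrite ler_wpM2r // ler_norm.
  by rewrite -mulrA ler_wpM2l.
Qed.

Lemma rop_id_proof : id \in right_op_pred.
Proof.
apply/right_op_predP/right_operatorP; split=> //.
by exists 1 => u; rewrite mul1r.
Qed.

Definition rop_comp (f g : rop) : rop := ROp (rop_comp_proof f g).
Definition rop_id : rop := ROp rop_id_proof.

Lemma ropP (f g : rop) : (forall u, f u = g u) -> f = g.
Proof. by move=> fg; apply: val_inj; apply: funext. Qed.

Lemma ropD (f : rop) u v : f (u + v) = f u + f v.
Proof. by have /right_op_predP[] := rop_funP f. Qed.

(* The product of [rop] is the composition of operators, so that [1], [f * g]
   and [f ^+ n] are the identity, the composite and the iterates. *)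
Let rop_compA : associative rop_comp.
Proof. by move=> f g h; apply: ropP. Qed.
Let rop_comp1l : left_id rop_id rop_comp.
Proof. by move=> f; apply: ropP. Qed.
Let rop_comp1r : right_id rop_id rop_comp.
Proof. by move=> f; apply: ropP. Qed.
Let rop_compDl : left_distributive rop_comp +%R.
Proof. by move=> f g h; apply: ropP. Qed.
Let rop_compDr : right_distributive rop_comp +%R.
Proof. by move=> f g h; apply: ropP => u; apply: ropD. Qed.

HB.instance Definition _ := GRing.Zmodule_isPzRing.Build rop
  rop_compA rop_comp1l rop_comp1r rop_compDl rop_compDr.

(* [sup set0 = 0], so the operator norm is 0 if X is trivial. *)
Definition opnorm (f : rop) : R := sup (opquot f).

Lemma rop0 (f : rop) : f 0 = 0.
Proof. by apply: (addrI (f 0)); rewrite -ropD !addr0. Qed.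

Lemma ler_opnorm (f : rop) u : `|f u| <= opnorm f * `|u|.
Proof.
have [_ _ fub] : right_operator f by apply/right_op_predP; apply: rop_funP.
have /opquot_ubound : f 0 = 0 by exact: rop0.
move=> /(_ (opnorm f))[+ _]; apply=> x fx; exact: ub_le_sup.
Qed.

Lemma opnorm_le (f : rop) (M : R) :
  0 <= M -> (forall u, `|f u| <= M * `|u|) -> opnorm f <= M.
Proof.
move=> M0 /(opquot_ubound _ (rop0 f)) fM; rewrite /opnorm.
have [->|/set0P fn0] := eqVneq (opquot f) set0; first by rewrite sup0.
exact: ge_sup.
Qed.

Lemma opnorm_ge0 (f : rop) : 0 <= opnorm f.
Proof.
have [f0|/set0P[x fx]] := eqVneq (opquot f) set0.
  by rewrite /opnorm f0 sup0.
have [_ _ fub] : right_operator f by apply/right_op_predP; apply: rop_funP.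
apply: (@le_trans _ _ x); last exact: ub_le_sup.
by case: fx => u _ <-; rewrite divr_ge0.
Qed.

Let opnormD (f g : rop) : opnorm (f + g) <= opnorm f + opnorm g.
Proof.
apply: opnorm_le => [|u]; first by rewrite addr_ge0 // opnorm_ge0.
by rewrite (le_trans (ler_normD _ _)) // mulrDl lerD // ler_opnorm.
Qed.

Let opnormZle (r : R) (f : rop) : opnorm (r *: f) <= `|r| * opnorm f.
Proof.
apply: opnorm_le => [|u]; first by rewrite mulr_ge0 // opnorm_ge0.
by rewrite normrZ -mulrA ler_wpM2l // ler_opnorm.
Qed.

Let opnormZ (r : R) (f : rop) : opnorm (r *: f) = `|r| * opnorm f.
Proof.
apply/eqP; rewrite eq_le opnormZle /=.
have [->|r0] := eqVneq r 0; first by rewrite normr0 mul0r opnorm_ge0.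
rewrite -ler_pdivlMl ?normr_gt0 // -normfV (le_trans _ (opnormZle _ _)) //.
by rewrite scalerA mulVf // scale1r.
Qed.

Let opnorm0_eq0 (f : rop) : opnorm f = 0 -> f = 0.
Proof.
move=> f0; apply: ropP => u; apply/normr0_eq0/eqP.
by rewrite eq_le normr_ge0 andbT -(mul0r `|u|) -f0 ler_opnorm.
Qed.

HB.instance Definition _ :=
  Lmodule_isNormed.Build R rop opnormD opnormZ opnorm0_eq0.

End RightOperators.
Arguments rop {R A} X.

Section HalfLine.
Variables (R : realType) (V : normedModType R).
Implicit Types (T : R -> V) (t : R).

(* Maps on [0, +oo[ are represented by maps on R whose values at negative
   reals are irrelevant: the derivative at [t >= 0] only involves increments
   [h] such that [t + h >= 0]; it is one-sided at [t = 0]. *)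
Definition derivable_ge0 T t : Prop :=
  cvg (h^-1 *: (T (t + h) - T t) @[h --> within [set h | 0 <= t + h] 0^']).

Definition derive_ge0 T t : V :=
  lim (h^-1 *: (T (t + h) - T t) @[h --> within [set h | 0 <= t + h] 0^']).

End HalfLine.

Section Semigroups.
Variables (R : realType) (A : coneAlgType R) (X : normedBimodType A).
Implicit Types (T : R -> rop X) (B : rop X).

Definition expop B : rop X :=
  limn (series (fun n => n`!%:R^-1 *: B ^+ n)).

Definition semigroup T : Prop :=
  (forall t s, 0 < t -> 0 < s -> T (t + s) = T t * T s) /\ T 0 = 1.

Definition uniformly_continuous_semigroup T : Prop :=
  semigroup T /\ {within `[0, +oo[, continuous T}.

Definition cauchy_solution B T : Prop :=
  (forall t, 0 <= t -> derivable_ge0 T t /\ derive_ge0 T t = B * T t) /\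
  T 0 = 1.

End Semigroups.

(* Main.v *)
Require Import Defs.
From HB Require Import structures.
From mathcomp Require Import all_boot all_order all_algebra.
From mathcomp Require Import all_classical all_reals all_analysis.
From mathcomp Require Import lra.

Import Order.TTheory GRing.Theory Num.Theory.
Import numFieldNormedType.Exports.
Local Open Scope classical_set_scope.
Local Open Scope ring_scope.

(** The right linear bounded operators form a Banach algebra: the operator norm
    is submultiplicative and a Cauchy filter of operators converges pointwise to
    an operator, hence in norm. Right linearity survives limits because every
    [ract _ a] is bounded; from there on only the Banach algebra structure is
    used.

    Part (b). Comparing the exponential series term by term with the real one
    gives
      |exp((t+h)B) - exp(tB) - h B exp(tB)| <= e^(|t||B|) (e^(|h||B|) - 1 - |h||B|),
    so that t |-> exp(tB) has derivative B exp(tB) ([expop_derive]). A function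
    with zero derivative on the half-line is constant
    ([is_derive_ge0_0_is_cst]). If f' = B f, then exp(-tB) f(t) has zero
    derivative, whence f(t) = exp(tB) f(0) ([cauchy_expop]). This gives the
    uniqueness of the solution and, for f(t) = exp((t+s)B), the semigroup law,
    without any Cauchy product of series.

    Part (a). The usual proof inverts the mean of T over a small interval; here
    the vector-valued integral is replaced by the geometric sum
      y^N - 1 = (y - 1) (1 + y + ... + y^(N-1)),   y = T(h).
    When the powers y^k stay close to 1, it says that y^N - 1 is nearly
    N (y - 1) ([pow_sub1_linear]). Used with a crude bound it shows that T is
    Lipschitz at 0 ([semigroup_lipschitz]); used again with that Lipschitz
    bound, it shows that the slopes (T(h) - 1)/h form a Cauchy family as h -> 0+
    ([slope0_dist], [slope0_cvg]). Their limit B is the derivative at 0, the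
    semigroup law propagates it to T' = B T, and part (b) identifies T with
    exp(tB). *)

(** * The Banach algebra of right linear operators *)

Lemma cvg_norm_squeeze {R : realType} {V : normedModType R} {T : Type}
    {F : set_system T} {FF : Filter F} (f : T -> V) (g : T -> R) (l : V) :
  (\forall x \near F, `|l - f x| <= g x) -> g @ F --> 0 -> f @ F --> l.
Proof.
move=> fg g0; apply/cvgrPdist_lt => e e0.
near=> x; apply: (@le_lt_trans _ _ (g x)); near: x => //.
exact: cvgr_lt g0 _ e0.
Unshelve. all: by end_near. Qed.

Section OperatorAlgebra.
Context {R : realType} {A : coneAlgType R} {X : normedBimodType A}.
Implicit Types (f g : rop X) (a : R) (n : nat).

Lemma ropZ f a u : f (a *: u) = a *: f u.
Proof. exact: additive_bounded_scale (ropD f) (ler_opnorm f) a u. Qed.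

Lemma rop_scalel a f g : (a *: f) * g = a *: (f * g).
Proof. by apply: ropP. Qed.

Lemma rop_scaler a f g : f * (a *: g) = a *: (f * g).
Proof. by apply: ropP => u; apply: ropZ. Qed.

Lemma rop_norm_mul f g : `|f * g| <= `|f| * `|g|.
Proof.
apply: opnorm_le => [|u]; first by rewrite mulr_ge0 // opnorm_ge0.
rewrite (le_trans (ler_opnorm f (g u))) // -mulrA ler_wpM2l ?opnorm_ge0 //.
exact: ler_opnorm.
Qed.

Lemma rop_norm1_le1 : `|1 : rop X| <= 1.
Proof. by apply: opnorm_le => // u; rewrite mul1r. Qed.

Lemma rop_norm_exp f n : `|f ^+ n| <= `|f| ^+ n.
Proof.
elim: n => [|n IH]; first exact: rop_norm1_le1.
by rewrite !exprS (le_trans (rop_norm_mul _ _)) // ler_wpM2l.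
Qed.

Lemma rop_exprZ a f n : (a *: f) ^+ n = a ^+ n *: f ^+ n.
Proof.
elim: n => [|n IH]; first by rewrite !expr0 scale1r.
by rewrite !exprS IH rop_scalel rop_scaler scalerA.
Qed.

Lemma rop_cvgM {T : Type} {F : set_system T} {FF : Filter F}
    (f g : T -> rop X) (k l : rop X) :
  f @ F --> k -> g @ F --> l -> (fun x => f x * g x) @ F --> k * l.
Proof.
move=> fk gl.
apply: (@cvg_norm_squeeze _ _ _ _ _ _
  (fun x => `|k - f x| * `|g x| + `|k| * `|l - g x|)).
  near=> x.
  have -> : k * l - f x * g x = (k - f x) * g x + k * (l - g x).
    by rewrite mulrBl mulrBr [RHS]addrC addrA subrK.
  by rewrite (le_trans (ler_normD _ _)) // lerD // rop_norm_mul.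
have d0 (h : T -> rop X) m : h @ F --> m -> (`|m - h x| @[x --> F] --> (0 : R)).
  move=> hm; rewrite -(normr0 (rop X)) -(subrr m).
  by apply: cvg_norm; apply: cvgB => //; exact: cvg_cst.
rewrite (_ : 0 = 0 * `|l| + `|k| * 0); last by rewrite mul0r mulr0 addr0.
apply: cvgD; apply: cvgM; [exact: d0|exact: cvg_norm|exact: cvg_cst|exact: d0].
Unshelve. all: by end_near. Qed.

End OperatorAlgebra.

Section Completeness.
Context {R : realType} {A : coneAlgType R} {X : banachBimodType A}.

(** Evaluation at [u] is Lipschitz with constant [`|u|]; [`|u| + 1] below avoids
    a division by zero when [u] is zero. *)
Lemma rop_eval_cvg (F : set_system (rop X)) {FF : ProperFilter F} :
  cauchy F -> forall u : X, cvg ((fun f : rop X => f u) @ F).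
Proof.
move=> cF u; apply: cauchy_cvg; apply/cauchyP => e e0.
have de : 0 < e / (`|u| + 1) by rewrite divr_gt0 // ltr_wpDl.
have [g Fg] := (cauchyP F).1 cF _ de.
exists (g u); rewrite nbhs_simpl /=; apply: filterS Fg => f.
rewrite -!ball_normE /= => fg.
rewrite (le_lt_trans (ler_opnorm (g - f) u)) //.
have u1 : `|u| < `|u| + 1 by rewrite ltrDl.
rewrite -(divfK (lt0r_neq0 (le_lt_trans (normr_ge0 u) u1)) e).
rewrite (le_lt_trans (ler_wpM2r (normr_ge0 _) (ltW fg))) //.
by rewrite ltr_pM2l.
Qed.

(** The limit operator is built pointwise. A Cauchy filter has, for each [e], an
    operator [g] around which it concentrates; letting the filter go to its
    pointwise limit [L] in [`|g u - f u| <= e * `|u|] bounds [g - L] by [e]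
    uniformly in [u], which gives both the boundedness of [L] and the
    convergence in norm. *)
Lemma rop_complete (F : set_system (rop X)) :
  ProperFilter F -> cauchy F -> cvg F.
Proof.
move=> FF cF.
pose L u := lim ((fun f : rop X => f u) @ F).
have evL u : (fun f : rop X => f u) @ F --> L u by exact: rop_eval_cvg.
have Llim u v : (fun f : rop X => f u) @ F --> v -> L u = v.
  by move=> /(cvg_lim (@norm_hausdorff _ _)).
have LD : {morph L : u v / u + v}.
  move=> u v; apply: Llim.
  rewrite (_ : (fun f : rop X => f (u + v)) = (fun f => f u + f v)); last first.
    by apply/funext => f; exact: ropD.
  by apply: cvgD; exact: evL.
have LA u (a : A) : L (ract u a) = ract (L u) a.
  apply: Llim.
  apply: (@cvg_norm_squeeze _ _ _ _ _ _
    (fun f : rop X => anorm a * `|L u - f u|)).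
    near=> f.
    have [_ fA _] : right_operator f by apply/right_op_predP; exact: rop_funP.
    rewrite fA -(scaleN1r (ract _ _)) -ractZ scaleN1r -ractDl.
    exact: ler_norm_ract.
  rewrite -[X in _ --> X](mulr0 (anorm a)) -(normr0 X) -(subrr (L u)).
  apply: cvgM; first exact: cvg_cst.
  by apply: cvg_norm; apply: cvgB; [exact: cvg_cst|exact: evL].
have near_bound e : 0 < e ->
    exists g : rop X, F (ball g e) /\ forall u, `|g u - L u| <= e * `|u|.
  move=> e0; have [g Fg] := (cauchyP F).1 cF _ e0.
  exists g; split => // u.
  have gL : (fun f : rop X => `|g u - f u|) @ F --> `|g u - L u|.
    by apply: cvg_norm; apply: cvgB; [exact: cvg_cst|exact: evL].
  apply: (cvgr_to_le gL); apply: filterS Fg => f.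
  rewrite -ball_normE /= => /ltW fg.
  exact: le_trans (ler_opnorm (g - f) u) (ler_wpM2r (normr_ge0 _) fg).
have Lop : L \in right_op_pred (X := X).
  apply/right_op_predP/right_operatorP; split => //.
  have [g [_ gL]] := near_bound 1 ltr01.
  exists (1 + `|g|) => u; rewrite mulrDl -[L u](subrK (g u)).
  rewrite (le_trans (ler_normD _ _)) // lerD //; last exact: ler_opnorm.
  by rewrite distrC gL.
apply/cvg_ex; exists (ROp Lop); apply/cvgrPdist_le => e e0.
have [g [Fg gL]] := near_bound _ (divr_gt0 e0 (ltr0n R 2)).
apply: filterS Fg => f; rewrite -ball_normE /= => /ltW gf.
rewrite -[_ - f](subrKA g) [e]splitr (le_trans (ler_normD _ _)) // lerD //.
rewrite -opprB normrN; apply: opnorm_le => [|u]; last exact: gL.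
by rewrite ltW // divr_gt0.
Unshelve. all: by end_near. Qed.

HB.instance Definition _ := Uniform_isComplete.Build (rop X) rop_complete.

End Completeness.

(** * Derivatives on the half-line *)

Section HalfLineCalculus.
Context {R : realType} {V : normedModType R}.
Implicit Types (f : R -> V) (t : R) (l : V).

(** The filter on which [derivable_ge0] and [derive_ge0] are taken. *)
Definition increments_ge0 t : set_system R := within [set h | 0 <= t + h] 0^'.

#[local] Instance increments_ge0_filter t : Filter (increments_ge0 t).
Proof. exact: within_filter. Qed.

(** The relational form of [derivable_ge0] and [derive_ge0]: it composes under
    the rules of calculus without existence side conditions. *)
Definition is_derive_ge0 f t l :=
  (fun h => h^-1 *: (f (t + h) - f t)) @ increments_ge0 t --> l.

(** Positive increments are always allowed, so the filter is coarser than
    the proper filter [0^'+]. *)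
Lemma increments_ge0_proper t : 0 <= t -> ProperFilter (increments_ge0 t).
Proof.
move=> t0; apply: Build_ProperFilter_ex => P tP.
suff : \forall h \near (0 : R)^'+, P h.
  by move=> P0; exact: (@filter_ex _ _ (at_right_proper_filter 0) P P0).
have : \forall h \near (0 : R)^', [set h | 0 <= t + h] h -> P h by exact: tP.
move=> /nbhs_ballP[e e0 eP]; exists e => // h eh h0.
by apply: eP => //=; [exact: lt0r_neq0 h0|rewrite addr_ge0 // ltW].
Qed.

Lemma is_derive_ge0P f t l : 0 <= t -> is_derive_ge0 f t l ->
  derivable_ge0 f t /\ derive_ge0 f t = l.
Proof.
move=> t0 fl; split; first by apply/cvg_ex; exists l.
have ? := increments_ge0_proper _ t0.
exact: (cvg_lim (@norm_hausdorff _ _) fl).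
Qed.

Lemma derivable_ge0P f t :
  derivable_ge0 f t -> is_derive_ge0 f t (derive_ge0 f t).
Proof. by []. Qed.

Lemma near_increments_neq0 t : \forall h \near increments_ge0 t, h != 0.
Proof. by have := nbhs_dnbhs_neq (0 : R); apply: cvg_within. Qed.

Lemma near_increments_ge0 t : \forall h \near increments_ge0 t, 0 <= t + h.
Proof. exact: withinT. Qed.

Lemma increments_ge0_cvg0 t : id @ increments_ge0 t --> (0 : R).
Proof. by apply: cvg_within_filter; exact: nbhs_dnbhs. Qed.

Lemma is_derive_ge0_cvg f t l : is_derive_ge0 f t l ->
  (fun h => f (t + h)) @ increments_ge0 t --> f t.
Proof.
move=> fl; apply/subr_cvg0.
have E : \forall h \near increments_ge0 t,
    h *: (h^-1 *: (f (t + h) - f t)) = f (t + h) - f t.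
  near=> h; rewrite scalerA mulfV ?scale1r //; near: h.
  exact: near_increments_neq0.
apply: cvg_trans (near_eq_cvg E) _; rewrite -(scale0r l).
exact: cvgZ (increments_ge0_cvg0 t) fl.
Unshelve. all: by end_near. Qed.

(** Increments are nonzero, whereas [within _ (nbhs t)] contains [t] itself; the
    value at [t] adds no constraint. *)
Lemma increments_ge0_continuous f t :
  (fun h => f (t + h)) @ increments_ge0 t --> f t ->
  f @ within [set x | 0 <= x] (nbhs t) --> f t.
Proof.
move=> ft; apply/cvgrPdist_lt => e e0.
have fte : \forall h \near (0 : R), h != 0 -> 0 <= t + h ->
    `|f t - f (t + h)| < e.
  by move/cvgrPdist_lt: ft; exact.
suff : \forall x \near t, 0 <= x -> `|f t - f x| < e by [].
rewrite nbhs0P; apply: filterS fte => h hP th.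
have [->|h0] := eqVneq h 0; first by rewrite addr0 subrr normr0.
exact: hP.
Qed.

Lemma is_derive_ge0_continuous f t l : is_derive_ge0 f t l ->
  f @ within [set x | 0 <= x] (nbhs t) --> f t.
Proof. by move=> /is_derive_ge0_cvg/increments_ge0_continuous. Qed.

Lemma is_derive_ge0_within_continuous f (f' : R -> V) :
  (forall t, 0 <= t -> is_derive_ge0 f t (f' t)) ->
  {within `[0, +oo[, continuous f}.
Proof.
move=> ff'; apply/subspace_continuousP => t; rewrite /= in_itv /= andbT => t0.
suff -> : [set` `[0, +oo[] = [set x : R | 0 <= x].
  exact: is_derive_ge0_continuous (ff' _ t0).
by apply/seteqP; split=> x /=; rewrite in_itv /= andbT.
Qed.

(** At interior points small increments of both signs are allowed, so one-sided
    derivatives are ordinary derivatives there. *)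
Lemma dnbhs_increments_gt0 t : 0 < t -> 0^' `=>` increments_ge0 t.
Proof.
move=> t0 P tP.
have th : \forall h \near (0 : R), 0 <= t + h.
  apply/nbhs_ballP; exists t => // h; rewrite -ball_normE /= sub0r normrN.
  by move=> /ltW; rewrite ler_norml -lerBlDl sub0r => /andP[].
have th' : \forall h \near (0 : R)^', 0 <= t + h by exact: nbhs_dnbhs th.
have tP' : \forall h \near (0 : R)^', 0 <= t + h -> P h by exact: tP.
near=> h; have th0 : 0 <= t + h by near: h.
by move: th0; near: h.
Unshelve. all: by end_near.
Qed.

(** The mean value theorem is real-valued, but it applies to
    [`|f s - f 0|]: its increments are dominated by those of [f], so its
    derivative also vanishes. *)
Lemma is_derive_ge0_0_is_cst f :
  (forall t, 0 <= t -> is_derive_ge0 f t 0) -> forall t, 0 <= t -> f t = f 0.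
Proof.
move=> f'0 t t0; pose g s := `|f s - f 0|.
have g_inc s s' : `|g s' - g s| <= `|f s' - f s|.
  by rewrite (le_trans (ler_dist_dist _ _)) // opprB addrA subrK.
have g'0 s : s \in `]0, t[%R -> is_derive s 1 g 0.
  rewrite in_itv /= => /andP[s0 _].
  have g'0 : (fun h => h^-1 *: ((g \o shift s) (h *: 1) - g s)) @ 0^' --> 0.
    apply: (@cvg_norm_squeeze _ _ _ _ _ _
      (fun h => `|h^-1 *: (f (s + h) - f s)|)).
      near=> h; rewrite /= sub0r normrN !normrZ ler_wpM2l // /shift /=.
      by rewrite [h *: 1]mulr1 [h + s]addrC; exact: g_inc.
    rewrite -[X in _ --> X](normr0 V); apply: cvg_norm.
    have := f'0 _ (ltW s0); apply: cvg_trans; apply: cvg_app.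
    exact: dnbhs_increments_gt0.
  by split; [apply/cvg_ex; exists 0|exact: cvg_lim g'0].
have gc : {within `[0, t], continuous g}.
  apply/subspace_continuousP => s; rewrite /= in_itv /= => /andP[s0 _].
  have f_s : f @ within [set x | 0 <= x] (nbhs s) --> f s.
    exact: is_derive_ge0_continuous (f'0 _ s0).
  have g_s : g @ within [set x | 0 <= x] (nbhs s) --> g s.
    by apply: cvg_norm; apply: cvgB => //; exact: cvg_cst.
  move: g_s; apply: cvg_trans; apply: cvg_app; apply: within_subset => x /=.
  by rewrite in_itv => /andP[].
have [c _] := MVT_segment t0 g'0 gc.
rewrite mul0r /g subrr normr0 subr0 => /normr0_eq0/eqP.
by rewrite subr_eq0 => /eqP.
Unshelve. all: by end_near. Qed.

End HalfLineCalculus.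

Section ProductRule.
Context {R : realType} {A : coneAlgType R} {X : normedBimodType A}.

Lemma is_derive_ge0M (f g : R -> rop X) (t : R) (l m : rop X) :
  is_derive_ge0 f t l -> is_derive_ge0 g t m ->
  is_derive_ge0 (fun s => f s * g s) t (l * g t + f t * m).
Proof.
move=> fl gm; rewrite /is_derive_ge0.
rewrite (_ : (fun h => _) = fun h =>
  (h^-1 *: (f (t + h) - f t)) * g (t + h) +
  f t * (h^-1 *: (g (t + h) - g t))); last first.
  apply/funext => h; rewrite rop_scalel rop_scaler -scalerDr.
  by rewrite mulrBl mulrBr addrA subrK.
apply: cvgD; apply: rop_cvgM => //; last exact: cvg_cst.
exact: is_derive_ge0_cvg gm.
Qed.

End ProductRule.

(** * The exponential of an operator *)

Section PowerRemainder.
Context {R : realType}.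
Implicit Types (t h : R) (n : nat).

(** The first-order Taylor remainder of [t ^+ n.+1]; the exponent is shifted so
    that the derivative needs no predecessor. *)
Definition pow_remainder n t h : R :=
  (t + h) ^+ n.+1 - t ^+ n.+1 - h * (n.+1%:R * t ^+ n).

Lemma pow_remainder0 t h : pow_remainder 0 t h = 0.
Proof. by rewrite /pow_remainder !expr1 expr0; lra. Qed.

Lemma pow_remainderS n t h : pow_remainder n.+1 t h =
  (t + h) * pow_remainder n t h + n.+1%:R * h ^+ 2 * t ^+ n.
Proof. by rewrite /pow_remainder !exprS -(natr1 n.+1); lra. Qed.

Lemma pow_remainder_fact n t h :
  n.+1`!%:R^-1 * (t + h) ^+ n.+1 - n.+1`!%:R^-1 * t ^+ n.+1
  - h * (n`!%:R^-1 * t ^+ n) = n.+1`!%:R^-1 * pow_remainder n t h.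
Proof.
rewrite /pow_remainder factS natrM.
have n1 : (n.+1%:R : R) != 0 by rewrite pnatr_eq0.
rewrite -mulrBr [RHS]mulrBr; congr (_ - _); rewrite invfM.
by rewrite [h * (_ * _ ^+ _) in RHS]mulrCA mulrACA mulVf // mul1r mulrCA.
Qed.

(** The scalar counterpart of [expop_coeff_remainder] below: both remainders are
    the same multiple of [b ^+ n.+1] and of [B ^+ n.+1], which makes the terms
    of the two series comparable. *)
Lemma exp_coeff_remainder n t h b :
  exp_coeff (t * b + h * b) n.+1 - exp_coeff (t * b) n.+1
  - h * b * exp_coeff (t * b) n
  = n.+1`!%:R^-1 * pow_remainder n t h * b ^+ n.+1.
Proof.
rewrite -pow_remainder_fact /exp_coeff /= -mulrDl !exprMn exprS.
move: (n.+1`!%:R^-1) (n`!%:R^-1) => u v; rewrite !exprS; lra.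
Qed.

(** The remainder is a polynomial in [t] and [h] with nonnegative coefficients,
    as [pow_remainderS] exhibits. *)
Lemma pow_remainder_norm n t h :
  `|pow_remainder n t h| <= pow_remainder n `|t| `|h|.
Proof.
elim: n => [|n IH]; first by rewrite !pow_remainder0 normr0.
rewrite !pow_remainderS (le_trans (ler_normD _ _)) // lerD //.
  by rewrite normrM ler_pM // ler_normD.
by rewrite !normrM normr_nat !normrX.
Qed.

(** This is [(1 - x) * expR x <= 1], a form of [1 - x <= expR (- x)]. The bound
    is quadratic near [0], as the derivative of the exponential requires. *)
Lemma expR_remainder_le (x : R) : expR x - 1 - x <= x * (expR x - 1).
Proof.
have : (1 - x) * expR x <= 1.
  rewrite -[leRHS](expRxMexpNx_1 x) [leRHS]mulrC ler_pM2r ?expR_gt0 //.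
  exact: expR_ge1Dx.
lra.
Qed.

End PowerRemainder.

Section Exponential.
Context {R : realType} {A : coneAlgType R} {X : banachBimodType A}.
Implicit Types (B : rop X) (t h : R) (n N : nat).

Definition expop_coeff B n : rop X := n`!%:R^-1 *: B ^+ n.

Lemma expop_coeff_norm B n : `|expop_coeff B n| <= exp_coeff `|B| n.
Proof.
rewrite normrZ normfV normr_nat /exp_coeff /= mulrC.
by rewrite ler_wpM2r ?invr_ge0 // rop_norm_exp.
Qed.

Lemma expop_cvg B : series (expop_coeff B) @ \oo --> expop B.
Proof.
suff : cvgn (series (expop_coeff B)) by [].
apply: normed_cvg; apply: series_le_cvg (is_cvg_series_exp_coeff `|B|) => n //.
- exact: normr_ge0.
- exact: exp_coeff_ge0.
- exact: expop_coeff_norm.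
Qed.

Lemma expop0 : expop (0 : rop X) = 1.
Proof.
have series1 n : series (expop_coeff 0) n.+1 = 1.
  elim: n => [|n IH]; rewrite seriesSr; last first.
    by rewrite IH /expop_coeff exprS mul0r scaler0 addr0.
  by rewrite /series /= big_geq // add0r /expop_coeff fact0 invr1 scale1r.
apply: (cvg_lim (@norm_hausdorff _ _)); rewrite -cvg_shiftS.
rewrite (_ : [sequence _]_n = fun=> 1); first exact: cvg_cst.
by apply/funext => n; exact: series1.
Qed.

Lemma expop_comm (C B : rop X) : GRing.comm C B -> GRing.comm C (expop B).
Proof.
move=> CB.
have CE : (fun n => C * series (expop_coeff B) n) @ \oo --> C * expop B.
  by apply: rop_cvgM; [exact: cvg_cst|exact: expop_cvg].
have EC : (fun n => C * series (expop_coeff B) n) @ \oo --> expop B * C.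
  rewrite (_ : (fun n => _) = fun n => series (expop_coeff B) n * C).
    by apply: rop_cvgM; [exact: expop_cvg|exact: cvg_cst].
  apply/funext => n; rewrite /series /= mulr_sumr mulr_suml.
  apply: eq_bigr => k _; rewrite rop_scaler rop_scalel.
  by congr (_ *: _); exact: commrX.
exact: (cvg_unique (@norm_hausdorff _ _) CE EC).
Qed.

Lemma expop_coeff_remainder B t h n :
  expop_coeff ((t + h) *: B) n.+1 - expop_coeff (t *: B) n.+1
  - h *: (B * expop_coeff (t *: B) n)
  = (n.+1`!%:R^-1 * pow_remainder n t h) *: B ^+ n.+1.
Proof.
rewrite /expop_coeff !rop_exprZ rop_scaler rop_scaler -exprS !scalerA -!scalerBl.
by congr (_ *: _); rewrite -pow_remainder_fact !mulrA.
Qed.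

(** Differentiation lowers the degree by one, so the series of the derivative is
    truncated one term earlier. *)
Lemma expop_series_remainder B t h N :
  `|series (expop_coeff ((t + h) *: B)) N.+1 - series (expop_coeff (t *: B)) N.+1
    - h *: (B * series (expop_coeff (t *: B)) N)|
  <= series (exp_coeff (`|t| * `|B| + `|h| * `|B|)) N.+1
     - series (exp_coeff (`|t| * `|B|)) N.+1
     - `|h| * `|B| * series (exp_coeff (`|t| * `|B|)) N.
Proof.
elim: N => [|N IH].
  rewrite !seriesSr /series /= !big_geq // !add0r /expop_coeff /exp_coeff /=.
  by rewrite !expr0 mulr0 scaler0 subr0 mulr0 subr0 !subrr normr0.
have -> : series (expop_coeff ((t + h) *: B)) N.+2
    - series (expop_coeff (t *: B)) N.+2
    - h *: (B * series (expop_coeff (t *: B)) N.+1)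
  = (series (expop_coeff ((t + h) *: B)) N.+1
     - series (expop_coeff (t *: B)) N.+1
     - h *: (B * series (expop_coeff (t *: B)) N))
    + (expop_coeff ((t + h) *: B) N.+1 - expop_coeff (t *: B) N.+1
       - h *: (B * expop_coeff (t *: B) N)).
  rewrite !(seriesSr (expop_coeff _) N.+1) (seriesSr (expop_coeff (t *: B)) N).
  rewrite mulrDr scalerDr !opprD.
  by rewrite [X in X + _ = _]addrACA [LHS]addrACA.
set x := `|t| * `|B|; set y := `|h| * `|B|.
have term : `|expop_coeff ((t + h) *: B) N.+1 - expop_coeff (t *: B) N.+1
    - h *: (B * expop_coeff (t *: B) N)|
    <= exp_coeff (x + y) N.+1 - exp_coeff x N.+1 - y * exp_coeff x N.
  rewrite /x /y exp_coeff_remainder expop_coeff_remainder.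
  rewrite normrZ normrM normfV normr_nat.
  apply: ler_pM; [by rewrite mulr_ge0 ?invr_ge0|by []| |exact: rop_norm_exp].
  by rewrite ler_wpM2l ?invr_ge0 // pow_remainder_norm.
apply: le_trans (ler_normD _ _) _; apply: le_trans (lerD IH term) _.
rewrite -/x -/y !(seriesSr (exp_coeff _) N.+1) (seriesSr (exp_coeff x) N).
lra.
Qed.

(** The right-hand side is the first-order remainder of the real exponential at
    [`|t| * `|B|] for the increment [`|h| * `|B|]. *)
Lemma expop_remainder B t h :
  `|expop ((t + h) *: B) - expop (t *: B) - h *: (B * expop (t *: B))|
  <= expR (`|t| * `|B|) * (expR (`|h| * `|B|) - 1 - `|h| * `|B|).
Proof.
have seriescS C : (fun N => series (expop_coeff C) N.+1) @ \oo --> expop C.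
  by rewrite cvg_shiftS; exact: expop_cvg.
have expc x : series (exp_coeff x) @ \oo --> expR x.
  exact: is_cvg_series_exp_coeff.
have expcS x : (fun N => series (exp_coeff x) N.+1) @ \oo --> expR x.
  by rewrite cvg_shiftS; exact: expc.
have -> : expR (`|t| * `|B|) * (expR (`|h| * `|B|) - 1 - `|h| * `|B|) =
    expR (`|t| * `|B| + `|h| * `|B|) - expR (`|t| * `|B|)
    - `|h| * `|B| * expR (`|t| * `|B|) by rewrite expRD; lra.
pose r N := series (expop_coeff ((t + h) *: B)) N.+1
  - series (expop_coeff (t *: B)) N.+1
  - h *: (B * series (expop_coeff (t *: B)) N).
pose s N := series (exp_coeff (`|t| * `|B| + `|h| * `|B|)) N.+1
  - series (exp_coeff (`|t| * `|B|)) N.+1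
  - `|h| * `|B| * series (exp_coeff (`|t| * `|B|)) N.
have rl : (fun N => `|r N|) @ \oo --> `|expop ((t + h) *: B)
    - expop (t *: B) - h *: (B * expop (t *: B))|.
  apply: cvg_norm; apply: cvgB; first by apply: cvgB; exact: seriescS.
  apply: cvgZ; first exact: cvg_cst.
  by apply: rop_cvgM; [exact: cvg_cst|exact: expop_cvg].
have sl : s @ \oo --> expR (`|t| * `|B| + `|h| * `|B|) - expR (`|t| * `|B|)
    - `|h| * `|B| * expR (`|t| * `|B|).
  apply: cvgB; first by apply: cvgB; exact: expcS.
  by apply: cvgM; [exact: cvg_cst|exact: expc].
by apply: (ler_cvg_to rl sl); apply: nearW => N; exact: expop_series_remainder.
Qed.

Lemma expop_derive B t :
  (fun h => h^-1 *: (expop ((t + h) *: B) - expop (t *: B))) @ 0^'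
  --> B * expop (t *: B).
Proof.
apply: (@cvg_norm_squeeze _ _ _ _ _ _
  (fun h => expR (`|t| * `|B|) * `|B| * (expR (`|h| * `|B|) - 1))).
  near=> h.
  have h0 : h != 0 by near: h; exact: nbhs_dnbhs_neq.
  have h_gt0 : 0 < `|h| by rewrite normr_gt0.
  rewrite -normrN opprB -(ler_pM2l h_gt0) -normrZ scalerBr scalerA mulfV //.
  rewrite scale1r.
  apply: le_trans (expop_remainder _ _ _) _.
  apply: (@le_trans _ _
    (expR (`|t| * `|B|) * (`|h| * `|B| * (expR (`|h| * `|B|) - 1)))).
    by rewrite ler_pM2l ?expR_gt0 // expR_remainder_le.
  lra.
rewrite [X in _ --> X](_ : _ =
    expR (`|t| * `|B|) * `|B| * (expR (`|0 : R| * `|B|) - 1)); last first.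
  by rewrite normr0 mul0r expR0 subrr mulr0.
apply: cvgM; first exact: cvg_cst.
apply: cvgB; last exact: cvg_cst.
apply: continuous_cvg; first exact: continuous_expR.
apply: cvgM; last exact: cvg_cst.
by apply: cvg_norm; exact: nbhs_dnbhs.
Unshelve. all: by end_near. Qed.

Lemma expop_is_derive_ge0 B t :
  is_derive_ge0 (fun s => expop (s *: B)) t (B * expop (t *: B)).
Proof. by apply: cvg_within_filter; exact: expop_derive. Qed.

Lemma expop_shift_is_derive_ge0 B s t :
  is_derive_ge0 (fun x => expop ((x + s) *: B)) t (B * expop ((t + s) *: B)).
Proof.
rewrite /is_derive_ge0.
rewrite (_ : (fun h => _) =
  fun h => h^-1 *: (expop ((t + s + h) *: B) - expop ((t + s) *: B))).
  by apply: cvg_within_filter; exact: expop_derive.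
by apply/funext => h; rewrite addrAC.
Qed.

(** Multiplying by the integrating factor [expop (t *: - B)] gives the
    derivative [- B * E * f + E * B * f] with [E] the factor, which vanishes
    since [B] commutes with its exponentials. *)
Lemma expopN_cauchy_cst B (f : R -> rop X) :
  (forall t, 0 <= t -> is_derive_ge0 f t (B * f t)) ->
  forall t, 0 <= t -> expop (t *: - B) * f t = f 0.
Proof.
move=> f'B t t0.
have -> : f 0 = expop (0 *: - B) * f 0 by rewrite scale0r expop0 mul1r.
apply: (is_derive_ge0_0_is_cst (fun s => expop (s *: - B) * f s)) => // s s0.
have -> : 0 = (- B * expop (s *: - B)) * f s + expop (s *: - B) * (B * f s).
  have BE : GRing.comm B (expop (s *: - B)).
    by apply: expop_comm; rewrite /GRing.comm rop_scaler rop_scalel mulrN mulNr.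
  by rewrite mulNr BE mulNr mulrA addNr.
exact: is_derive_ge0M (expop_is_derive_ge0 _ _) (f'B _ s0).
Qed.

(** The previous lemma for [- B] and its own solution [expop (s *: - B)]. *)
Lemma expop_mulN B t : 0 <= t -> expop (t *: B) * expop (t *: - B) = 1.
Proof.
move=> t0; rewrite -[X in expop (t *: X) * _](opprK B).
rewrite (expopN_cauchy_cst (- B) (fun s => expop (s *: - B))) //.
  by rewrite scale0r expop0.
by move=> s _; exact: expop_is_derive_ge0.
Qed.

Lemma cauchy_expop B (f : R -> rop X) :
  (forall t, 0 <= t -> is_derive_ge0 f t (B * f t)) ->
  forall t, 0 <= t -> f t = expop (t *: B) * f 0.
Proof.
move=> f'B t t0; rewrite -(expopN_cauchy_cst _ _ f'B _ t0) mulrA.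
by rewrite expop_mulN // mul1r.
Qed.

(** Both sides solve the Cauchy problem of [B] in the variable [t], with the same
    value [expop (s *: B)] at [0]. *)
Lemma expopD B t s : 0 <= t ->
  expop ((t + s) *: B) = expop (t *: B) * expop (s *: B).
Proof.
move=> t0; have := cauchy_expop B (fun x => expop ((x + s) *: B)) _ t t0.
rewrite add0r; apply => x _; exact: expop_shift_is_derive_ge0.
Qed.

End Exponential.

(** * Differentiability of uniformly continuous semigroups *)

Lemma euclidean_step {R : realType} (h t : R) : 0 < h -> 0 <= t ->
  exists N : nat, exists r, [/\ t = N%:R * h + r, 0 <= r & r < h].
Proof.
move=> h0 t0; exists (Num.truncn (t / h)), (t - (Num.truncn (t / h))%:R * h).
have /andP[le_t t_lt] : (Num.truncn (t / h))%:R <= t / h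
    < (Num.truncn (t / h)).+1%:R.
  by apply: truncn_itv; rewrite divr_ge0 // ltW.
move: le_t t_lt; rewrite ler_pdivlMr // ltr_pdivrMr // -natr1 => le_t t_lt.
split; lra.
Qed.

Section SemigroupSlopes.
Context {R : realType} {A : coneAlgType R} {X : normedBimodType A}.

(** By the geometric sum, the difference is [y - 1] times the sum of the
    [y ^+ k - 1]. *)
Lemma pow_sub1_linear (y : rop X) (N : nat) (q : R) :
  (forall k, (k < N)%N -> `|y ^+ k - 1| <= q) ->
  `|(y ^+ N - 1) - (y - 1) *+ N| <= N%:R * (`|y - 1| * q).
Proof.
move=> yq; rewrite subrX1.
have -> : (y - 1) *+ N = (y - 1) * \sum_(k < N) 1.
  by rewrite sumr_const card_ord mulr_natr.
rewrite -mulrBr -sumrB (le_trans (rop_norm_mul _ _)) // mulrCA ler_wpM2l //.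
rewrite (le_trans (ler_norm_sum _ _ _)) // mulr_natl -[X in _ *+ X]card_ord.
by rewrite -sumr_const ler_sum // => k _; apply: yq.
Qed.

Context (T : R -> rop X) (sgT : semigroup T).

Lemma semigroupD t s : 0 <= t -> 0 <= s -> T (t + s) = T t * T s.
Proof.
have [TD T0] := sgT.
rewrite le_eqVlt => /predU1P[<-|t0]; first by rewrite T0 add0r mul1r.
rewrite le_eqVlt => /predU1P[<-|s0]; first by rewrite T0 addr0 mulr1.
exact: TD.
Qed.

Lemma semigroupMn h k : 0 <= h -> T (k%:R * h) = T h ^+ k.
Proof.
move=> h0; elim: k => [|k IH]; first by rewrite mul0r sgT.2.
by rewrite -natr1 mulrDl mul1r addrC semigroupD ?mulr_ge0 // IH exprS.
Qed.

(** Let [N] be maximal with [N * h <= d]. By [pow_sub1_linear] with [q = 1/2],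
    [N * `|T h - 1|] is at most [`|T (N * h) - 1| <= 1/2] plus half of itself,
    so it is at most [1]; and [N >= d / (2 * h)] by maximality. *)
Lemma semigroup_lipschitz (d : R) : 0 < d ->
  (forall h : R, 0 <= h <= d -> `|T h - 1| <= 2^-1) ->
  forall h : R, 0 <= h <= d -> `|T h - 1| <= 2 / d * h.
Proof.
move=> d0 Td h /andP[]; rewrite le_eqVlt => /predU1P[<- _|h0 hd].
  by rewrite sgT.2 subrr normr0 mulr0.
have [N [r [dE r0 rh]]] := euclidean_step _ _ h0 (ltW d0).
have kh k : (k <= N)%N -> `|T h ^+ k - 1| <= 2^-1.
  move=> kN; rewrite -semigroupMn ?(ltW h0) //; apply: Td.
  have kh : k%:R * h <= N%:R * h by rewrite ler_pM2r // ler_nat.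
  have kh0 : 0 <= k%:R * h by rewrite mulr_ge0 // ltW.
  lra.
have N_small : N%:R * `|T h - 1| <= 1.
  have := pow_sub1_linear (T h) N 2^-1 (fun k kN => kh k (ltnW kN)).
  have := kh N (leqnn _).
  have := lerB_dist ((T h - 1) *+ N) (T h ^+ N - 1).
  by rewrite distrC normrMn -mulr_natl; lra.
have dN : d <= 2 * (N%:R * h).
  have : 1 <= (N%:R : R).
    rewrite ler1n lt0n; apply/eqP => N0; move: dE; rewrite N0; lra.
  by move=> /(ler_pM (ltW h0) ler01 (lexx h)) => ?; lra.
rewrite mulrAC ler_pdivlMr // mulrC.
apply: (@le_trans _ _ (2 * (N%:R * h) * `|T h - 1|)).
  by rewrite ler_wpM2r.
have := ler_wpM2l (ltW h0) N_small; lra.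
Qed.

(** The difference quotient of [T] at [0], as [T 0 = 1]. *)
Definition slope0 (h : R) : rop X := h^-1 *: (T h - 1).

(** With [t = N * h + r], replacing [T t - 1] by [(t / h) *: (T h - 1)] costs three
    errors: the deviation of [T h ^+ N - 1] from [N] times [T h - 1], at most
    [K ^+ 2 * t ^+ 2] by [pow_sub1_linear] with [q = K * t]; the last, incomplete
    step from [N * h] to [t]; and the fraction [r / h] of a step. The last two
    are at most [2 * K * h] and [K * h]. The second summand of the bound vanishes
    as [h] tends to [0] with [t] fixed. *)
Lemma slope0_dist (K d : R) : 0 <= K ->
  (forall h : R, 0 <= h <= d -> `|T h - 1| <= 2^-1) ->
  (forall h : R, 0 <= h <= d -> `|T h - 1| <= K * h) ->
  forall h t : R, 0 < h -> h <= t -> t <= d ->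
  `|slope0 t - slope0 h| <= K ^+ 2 * t + 3 * K * (h / t).
Proof.
move=> K0 Thalf TK h t h0 ht td.
have t0 : 0 < t by exact: lt_le_trans ht.
have [N [r [tE r0 rh]]] := euclidean_step _ _ h0 (ltW t0).
have N0 : 0 <= (N%:R : R) by [].
have Nh0 : 0 <= N%:R * h by rewrite mulr_ge0 // ltW.
have decomp : T t - 1 - (t / h) *: (T h - 1) =
    ((T h ^+ N - 1) - (T h - 1) *+ N) + T (N%:R * h) * (T r - 1)
    - (r / h) *: (T h - 1).
  rewrite {1 2}tE semigroupD // semigroupMn ?(ltW h0) //.
  rewrite mulrDl mulfK ?gt_eqF // scalerDl scaler_nat mulrBr mulr1.
  rewrite opprD addrA; congr (_ - _).
  by rewrite [RHS]addrC -[T h ^+ N - 1 - _]addrA addrA subrK addrA.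
have b1 : `|(T h ^+ N - 1) - (T h - 1) *+ N| <= K ^+ 2 * t ^+ 2.
  have Nht : N%:R * h <= t by lra.
  apply: le_trans (pow_sub1_linear _ _ (K * t) _) _ => [k kN|].
    have kh : k%:R * h <= N%:R * h by rewrite ler_pM2r // ler_nat ltnW.
    have kh0 : 0 <= k%:R * h by rewrite mulr_ge0 // ltW.
    rewrite -semigroupMn ?(ltW h0) //; apply: le_trans (TK _ _) _; first by lra.
    by rewrite ler_wpM2l //; lra.
  rewrite (_ : K ^+ 2 * t ^+ 2 = (K * t) * (K * t)); last by lra.
  rewrite mulrA ler_wpM2r ?mulr_ge0 ?(ltW t0) //.
  apply: (@le_trans _ _ (N%:R * (K * h))); last first.
    by rewrite mulrCA ler_wpM2l.
  by rewrite ler_wpM2l // TK //; lra.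
have b2 : `|T (N%:R * h) * (T r - 1)| <= 2 * K * h.
  apply: le_trans (rop_norm_mul _ _) _; rewrite -mulrA.
  apply: ler_pM => //; last first.
    by apply: le_trans (TK _ _) _; [lra|rewrite ler_wpM2l // ltW].
  rewrite -[T _](subrK 1); apply: le_trans (ler_normD _ _) _.
  have := rop_norm1_le1 (X := X).
  have : `|T (N%:R * h) - 1| <= 2^-1 by apply: Thalf; lra.
  lra.
have b3 : `|(r / h) *: (T h - 1)| <= K * h.
  rewrite normrZ ger0_norm; last by rewrite divr_ge0 // ltW.
  have rh1 : r / h <= 1 by rewrite ler_pdivrMr // mul1r ltW.
  apply: (@le_trans _ _ (1 * `|T h - 1|)); first by rewrite ler_wpM2r.
  by rewrite mul1r; apply: TK; lra.
have -> : slope0 t - slope0 h = t^-1 *: (T t - 1 - (t / h) *: (T h - 1)).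
  by rewrite scalerBr scalerA mulrA mulVf ?gt_eqF // mul1r.
rewrite normrZ gtr0_norm ?invr_gt0 // mulrC ler_pdivrMr //.
rewrite decomp; apply: le_trans (ler_normB _ _) _.
apply: le_trans (lerD (le_trans (ler_normD _ _) (lerD b1 b2)) b3) _.
have : h / t * t = h by rewrite divfK // gt_eqF.
move: (h / t) => x xE.
have xE' : 3 * K * x * t = 3 * K * h by rewrite -xE mulrA.
lra.
Qed.

End SemigroupSlopes.

Section UniformlyContinuousSemigroups.
Context {R : realType} {A : coneAlgType R} {X : banachBimodType A}.
Context (T : R -> rop X) (ucT : uniformly_continuous_semigroup T).

Lemma semigroup_continuous_ge0 (t : R) : 0 <= t ->
  T @ within [set x | 0 <= x] (nbhs t) --> T t.
Proof.
move=> t0; have /subspace_continuousP := ucT.2.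
rewrite (_ : [set` `[0, +oo[] = [set x : R | 0 <= x]); first exact.
by apply/seteqP; split=> x /=; rewrite in_itv /= andbT.
Qed.

(** Cauchy criterion: for given [e], fix [t] so small that the first term of
    [slope0_dist] is at most [e / 4]; then all slopes at small [h] lie within
    [e] of the slope at [t]. *)
Lemma slope0_cvg : exists B : rop X, slope0 T @ 0^'+ --> B.
Proof.
have sgT := ucT.1.
have [d d0 Td] : exists2 d : R, 0 < d &
    forall h : R, 0 <= h <= d -> `|T h - 1| <= 2^-1.
  have /cvgrPdist_le/(_ 2^-1) := semigroup_continuous_ge0 _ (lexx 0).
  rewrite invr_gt0 ltr0n => /(_ isT)/nbhs_ballP[e /= e0 eT].
  exists (e / 2) => [|h /andP[h0 he]]; first by rewrite divr_gt0.
  rewrite -sgT.2 distrC; apply: eT => //.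
  rewrite -ball_normE /= sub0r normrN ger0_norm //; lra.
have TK := semigroup_lipschitz _ sgT _ d0 Td.
move: TK; set K := 2 / d => TK.
have K0 : 0 < K by rewrite divr_gt0.
suff /cauchy_cvg/cvg_ex : cauchy (slope0 T @ 0^'+) by [].
apply: cauchy_exP => e e0.
pose t := Num.min d (e / (4 * K ^+ 2)).
have K2 : 0 < 4 * K ^+ 2 by rewrite mulr_gt0 // exprn_gt0.
have t0 : 0 < t by rewrite lt_min d0 divr_gt0.
have td : t <= d by rewrite ge_min lexx.
have tK : 4 * K ^+ 2 * t <= e by rewrite mulrC -ler_pdivlMr // ge_min lexx orbT.
exists (slope0 T t).
have small h : 0 < h -> h <= t -> h <= e / (12 * K) * t ->
    `|slope0 T t - slope0 T h| < e.
  move=> h0 ht hs.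
  apply: le_lt_trans (slope0_dist _ sgT _ _ (ltW K0) Td TK _ _ h0 ht td) _.
  have K12 : 0 < 12 * K by rewrite mulr_gt0.
  have : h / t * (12 * K) <= e by rewrite -ler_pdivlMr // ler_pdivrMr.
  move: (h / t) => x; lra.
rewrite nbhs_simpl /=; near=> h; rewrite -ball_normE /=; apply: small.
- by near: h; exact: nbhs_right_gt.
- by near: h; exact: nbhs_right_le.
- by near: h; apply: nbhs_right_le; rewrite mulr_gt0 // divr_gt0 // mulr_gt0.
Unshelve. all: by end_near. Qed.

(** Factoring out the value of [T] at the earlier of the two times [t] and
    [t + h] treats the left and right difference quotients alike. *)
Lemma increment_slope0 (t h : R) : 0 <= t -> 0 <= t + h -> h != 0 ->
  h^-1 *: (T (t + h) - T t) = slope0 T `|h| * T (Num.min t (t + h)).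
Proof.
move=> t0 th0; have TD := semigroupD _ ucT.1.
rewrite neq_lt => /orP[h0|h0]; rewrite /slope0 rop_scalel mulrBl mul1r.
  rewrite ltr0_norm // minEle lerDl leNgt h0 /= -TD ?oppr_ge0 ?(ltW h0) //.
  rewrite [- h + _]addrCA addNr addr0.
  by rewrite invrN scaleNr -scalerN opprB.
rewrite gtr0_norm // minEle lerDl (ltW h0) /=.
by rewrite [t + h]addrC TD // ltW.
Qed.

Lemma semigroup_is_derive_ge0 (B : rop X) (t : R) :
  slope0 T @ 0^'+ --> B -> 0 <= t -> is_derive_ge0 T t (B * T t).
Proof.
move=> TB t0.
have h0 : (fun h => `|h|) @ increments_ge0 t --> (0 : R)^'+.
  move=> P /nbhs_ballP[e /= e0 eP].
  have near_e : \forall h \near (0 : R)^', `|h| < e.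
    apply: nbhs_dnbhs; apply/nbhs_ballP; exists e => // h.
    by rewrite -ball_normE /= sub0r normrN.
  suff : \forall h \near increments_ge0 t, P `|h| by [].
  near=> h; apply: eP; rewrite /= -?ball_normE /= ?sub0r ?normrN ?normr_id.
    by near: h; exact: cvg_within near_e.
  by rewrite normr_gt0; near: h; exact: near_increments_neq0.
have mint : (fun h => Num.min t (t + h)) @ increments_ge0 t
    --> within [set x | 0 <= x] (nbhs t).
  have min_cvg : (fun h => Num.min t (t + h)) @ increments_ge0 t --> t.
    apply: (@cvg_norm_squeeze _ _ _ _ _ _ (fun h => `|h|)).
      apply: nearW => h; rewrite minElt; case: ifP => _.
        by rewrite subrr normr0.
      by rewrite opprD addrA subrr sub0r normrN.
    rewrite -[X in _ --> X](normr0 R); apply: cvg_norm.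
    exact: increments_ge0_cvg0.
  move=> P tP.
  have minP : \forall h \near increments_ge0 t,
      0 <= Num.min t (t + h) -> P (Num.min t (t + h)) by exact: min_cvg tP.
  suff : \forall h \near increments_ge0 t, P (Num.min t (t + h)) by [].
  near=> h; have : 0 <= Num.min t (t + h).
    by rewrite le_min t0 /=; near: h; exact: near_increments_ge0.
  by near: h.
have : (fun h => slope0 T `|h| * T (Num.min t (t + h))) @ increments_ge0 t
    --> B * T t.
  apply: rop_cvgM; first exact: cvg_comp h0 TB.
  exact: cvg_comp mint (semigroup_continuous_ge0 _ t0).
apply: cvg_trans; apply: near_eq_cvg; near=> h.
apply/esym/increment_slope0 => //.
- by near: h; exact: near_increments_ge0.
- by near: h; exact: near_increments_neq0.
Unshelve. all: by end_near. Qed.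

End UniformlyContinuousSemigroups.

Theorem theorem4p3 (R : realType) (A : coneAlgType R) (X : banachBimodType A) :
  (forall T : R -> rop X, uniformly_continuous_semigroup T ->
     (forall t : R, 0 <= t -> derivable_ge0 T t) /\
     (let B := derive_ge0 T 0 in
      [/\ forall t : R, 0 <= t -> derive_ge0 T t = B * T t,
          T 0 = 1
        & forall t : R, 0 <= t -> T t = expop (t *: B)]))
  /\
  (forall B : rop X,
     [/\ uniformly_continuous_semigroup (fun t : R => expop (t *: B)),
         cauchy_solution B (fun t : R => expop (t *: B))
       & forall S : R -> rop X, cauchy_solution B S ->
           forall t : R, 0 <= t -> S t = expop (t *: B)]).
Proof.
split=> [T ucT|B].
  have T0 : T 0 = 1 := ucT.1.2.
  have [B TB] := slope0_cvg _ ucT.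
  have T'B (t : R) : 0 <= t -> is_derive_ge0 T t (B * T t).
    exact: semigroup_is_derive_ge0.
  have BE : derive_ge0 T 0 = B.
    by rewrite (is_derive_ge0P _ _ _ (lexx 0) (T'B 0 (lexx 0))).2 T0 mulr1.
  split=> [t t0|/=]; first exact: (is_derive_ge0P _ _ _ t0 (T'B t t0)).1.
  rewrite BE; split=> // t t0.
    exact: (is_derive_ge0P _ _ _ t0 (T'B t t0)).2.
  by rewrite (cauchy_expop _ _ T'B) // T0 mulr1.
have E0 : expop (0 *: B) = 1 by rewrite scale0r expop0.
split.
- split; last first.
    exact: is_derive_ge0_within_continuous (fun t _ => expop_is_derive_ge0 B t).
  by split=> // t s t0 _; rewrite expopD // ltW.
- by split=> // t t0; exact: is_derive_ge0P t0 (expop_is_derive_ge0 B t).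
- move=> S [S'B S0] t t0; rewrite (cauchy_expop B S) // ?S0 ?mulr1 // => s s0.
  by have [dS <-] := S'B s s0; exact: derivable_ge0P.
Qed.
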